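(* For all real numbers $a,b>0$, the following three chains of inequalities hold: $$M_{SA}(a,b)\le \tfrac45 M_{SN_2}(a,b)\le 4M_{AN_2}(a,b),$$ $$M_{SH}(a,b)\le 2M_{SN_1}(a,b)\le \tfrac32 M_{SG}(a,b),$$ and $$M_{SA}(a,b)\le \tfrac34 M_{SN_3}(a,b)\le \tfrac23 M_{SN_1}(a,b).$$
   Context: For $a,b>0$ define the means $H(a,b)=\frac{2ab}{a+b}$, $G(a,b)=\sqrt{ab}$, $N_1(a,b)=\left(\frac{\sqrt a+\sqrt b}{2}\right)^2$, $N_2(a,b)=\left(\frac{\sqrt a+\sqrt b}{2}\right)\sqrt{\frac{a+b}{2}}$, $N_3(a,b)=\frac{a+\sqrt{ab}+b}{3}$, $A(a,b)=\frac{a+b}{2}$, $S(a,b)=\sqrt{\frac{a^2+b^2}{2}}$. The differences of means are $M_{SA}=S-A$, $M_{SN_1}=S-N_1$, $M_{SN_2}=S-N_2$, $M_{SN_3}=S-N_3$, $M_{SG}=S-G$, $M_{SH}=S-H$, $M_{AN_2}=A-N_2$, each evaluated at $(a,b)$. *)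

(* Defs.v *)
From Stdlib Require Import Reals.
Local Open Scope R_scope.

Definition mean_H (a b : R) : R := 2 * a * b / (a + b).
Definition mean_G (a b : R) : R := sqrt (a * b).
Definition mean_N1 (a b : R) : R := ((sqrt a + sqrt b) / 2) ^ 2.
Definition mean_N2 (a b : R) : R :=
  ((sqrt a + sqrt b) / 2) * sqrt ((a + b) / 2).
Definition mean_N3 (a b : R) : R := (a + sqrt (a * b) + b) / 3.
Definition mean_A (a b : R) : R := (a + b) / 2.
Definition mean_S (a b : R) : R := sqrt ((a ^ 2 + b ^ 2) / 2).

Definition M_SA (a b : R) : R := mean_S a b - mean_A a b.
Definition M_SN1 (a b : R) : R := mean_S a b - mean_N1 a b.
Definition M_SN2 (a b : R) : R := mean_S a b - mean_N2 a b.
Definition M_SN3 (a b : R) : R := mean_S a b - mean_N3 a b.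
Definition M_SG (a b : R) : R := mean_S a b - mean_G a b.
Definition M_SH (a b : R) : R := mean_S a b - mean_H a b.
Definition M_AN2 (a b : R) : R := mean_A a b - mean_N2 a b.

(* Main.v *)
Require Import Defs.
From Stdlib Require Import Reals Lra Psatz.
Local Open Scope R_scope.

(** All seven means are algebraic functions of [A] and [G]:
    [H = G^2 / A], [N1 = (A + G) / 2], [N2 = sqrt (A * N1)],
    [N3 = (2 * A + G) / 3] and [S = sqrt (2 * A^2 - G^2)].  Since [N1] and [N3]
    are linear in [A] and [G], expanding the differences of means shows that
    the six inequalities of the three chains are only three distinct ones:
    - [S + 4 * N2 <= 5 * A], which is equivalent to both steps of the first
      chain;
    - [A + G <= S + H], the first step of the second chain;
    - [S + G <= 2 * A], equivalent to the last step of the second chain and to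
      both steps of the third.
    Each of them compares [S] with an expression without [S].  After squaring,
    the difference of the two sides is a polynomial which factors, and it is
    nonnegative because [0 <= G <= A]. *)

Lemma le_of_pow2_le (x y : R) : 0 <= y -> x ^ 2 <= y ^ 2 -> x <= y.
Proof. intros hy h; nra. Qed.

Lemma mean_A_pos (a b : R) : 0 < a -> 0 < b -> 0 < mean_A a b.
Proof. unfold mean_A; lra. Qed.

Lemma mean_G_nonneg (a b : R) : 0 <= mean_G a b.
Proof. apply sqrt_pos. Qed.

Lemma mean_S_nonneg (a b : R) : 0 <= mean_S a b.
Proof. apply sqrt_pos. Qed.

Lemma mean_N2_nonneg (a b : R) : 0 <= mean_N2 a b.
Proof.
  unfold mean_N2.
  pose proof (sqrt_pos a); pose proof (sqrt_pos b).
  apply Rmult_le_pos; [lra | apply sqrt_pos].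
Qed.

Lemma mean_G_sqr (a b : R) : 0 < a -> 0 < b -> mean_G a b ^ 2 = a * b.
Proof. intros ha hb; apply pow2_sqrt; nra. Qed.

Lemma mean_G_le_A (a b : R) : 0 < a -> 0 < b -> mean_G a b <= mean_A a b.
Proof.
  intros ha hb; apply le_of_pow2_le.
  - now apply Rlt_le, mean_A_pos.
  - rewrite mean_G_sqr by assumption; unfold mean_A.
    pose proof (pow2_ge_0 (a - b)); nra.
Qed.

Lemma mean_S_sqr (a b : R) : 0 < a -> 0 < b ->
  mean_S a b ^ 2 = 2 * mean_A a b ^ 2 - mean_G a b ^ 2.
Proof.
  intros ha hb; rewrite mean_G_sqr by assumption.
  unfold mean_S, mean_A; rewrite pow2_sqrt by nra; field.
Qed.

Lemma mean_H_eq (a b : R) : 0 < a -> 0 < b ->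
  mean_H a b = mean_G a b ^ 2 / mean_A a b.
Proof.
  intros ha hb; rewrite mean_G_sqr by assumption.
  unfold mean_H, mean_A; field; lra.
Qed.

Lemma mean_N1_eq (a b : R) : 0 < a -> 0 < b ->
  mean_N1 a b = (mean_A a b + mean_G a b) / 2.
Proof.
  intros ha hb; unfold mean_N1, mean_A, mean_G.
  rewrite sqrt_mult by lra.
  pose proof (pow2_sqrt a (Rlt_le _ _ ha)).
  pose proof (pow2_sqrt b (Rlt_le _ _ hb)).
  nra.
Qed.

Lemma mean_N3_eq (a b : R) : mean_N3 a b = (2 * mean_A a b + mean_G a b) / 3.
Proof. unfold mean_N3, mean_A, mean_G; field. Qed.

Lemma mean_N2_sqr (a b : R) : 0 < a -> 0 < b ->
  mean_N2 a b ^ 2 = mean_A a b * (mean_A a b + mean_G a b) / 2.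
Proof.
  intros ha hb.
  replace (mean_A a b * (mean_A a b + mean_G a b) / 2)
    with (mean_N1 a b * mean_A a b) by (rewrite mean_N1_eq by assumption; field).
  unfold mean_N2, mean_N1, mean_A.
  rewrite Rpow_mult_distr, (pow2_sqrt ((a + b) / 2)) by lra; reflexivity.
Qed.

Lemma mean_N2_le_A (a b : R) : 0 < a -> 0 < b -> mean_N2 a b <= mean_A a b.
Proof.
  intros ha hb.
  pose proof (mean_A_pos a b ha hb); pose proof (mean_G_le_A a b ha hb).
  apply le_of_pow2_le; [lra |].
  rewrite mean_N2_sqr by assumption; nra.
Qed.

(** Squaring [S <= 2 * A - G] leaves the difference [2 * (A - G)^2]. *)
Lemma mean_S_plus_G_le (a b : R) : 0 < a -> 0 < b ->
  mean_S a b + mean_G a b <= 2 * mean_A a b.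
Proof.
  intros ha hb.
  pose proof (mean_A_pos a b ha hb); pose proof (mean_G_le_A a b ha hb).
  enough (mean_S a b <= 2 * mean_A a b - mean_G a b) by lra.
  apply le_of_pow2_le; [lra |].
  rewrite mean_S_sqr by assumption.
  pose proof (pow2_ge_0 (mean_A a b - mean_G a b)); nra.
Qed.

(** Multiplying by [A] clears the denominator of [H]; squaring
    [A^2 + A * G - G^2 <= A * S] then leaves the difference
    [(A - G)^3 * (A + G)]. *)
Lemma mean_A_plus_G_le (a b : R) : 0 < a -> 0 < b ->
  mean_A a b + mean_G a b <= mean_S a b + mean_H a b.
Proof.
  intros ha hb.
  pose proof (mean_A_pos a b ha hb) as hA.
  pose proof (mean_G_nonneg a b) as hG.
  pose proof (mean_G_le_A a b ha hb) as hGA.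
  pose proof (mean_S_nonneg a b) as hS.
  pose proof (mean_S_sqr a b ha hb) as hS2.
  rewrite mean_H_eq by assumption.
  set (A := mean_A a b) in *; set (G := mean_G a b) in *;
    set (S := mean_S a b) in *.
  assert (h : A ^ 2 + A * G - G ^ 2 <= A * S).
  { apply le_of_pow2_le; [nra |].
    enough (0 <= (A * S) ^ 2 - (A ^ 2 + A * G - G ^ 2) ^ 2) by lra.
    replace ((A * S) ^ 2) with (A ^ 2 * (2 * A ^ 2 - G ^ 2))
      by (rewrite <- hS2; ring).
    replace (A ^ 2 * (2 * A ^ 2 - G ^ 2) - (A ^ 2 + A * G - G ^ 2) ^ 2)
      with ((A - G) ^ 3 * (A + G)) by ring.
    apply Rmult_le_pos; [apply pow_le |]; lra. }
  apply Rmult_le_reg_l with A; [exact hA |].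
  replace (A * (S + G ^ 2 / A)) with (A * S + G ^ 2) by (field; lra).
  lra.
Qed.

(** The relation [A * G = 2 * N2^2 - A^2] makes [(A * S)^2] a polynomial in [A]
    and [N2]; squaring [A * S <= A * (5 * A - 4 * N2)] then leaves the
    difference [4 * (A - N2)^2 * (N2^2 + 2 * A * N2 + 6 * A^2)]. *)
Lemma mean_S_plus_4N2_le (a b : R) : 0 < a -> 0 < b ->
  mean_S a b + 4 * mean_N2 a b <= 5 * mean_A a b.
Proof.
  intros ha hb.
  pose proof (mean_A_pos a b ha hb) as hA.
  pose proof (mean_N2_nonneg a b) as hN.
  pose proof (mean_N2_le_A a b ha hb) as hNA.
  pose proof (mean_N2_sqr a b ha hb) as hN2.
  pose proof (mean_S_sqr a b ha hb) as hS2.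
  set (A := mean_A a b) in *; set (G := mean_G a b) in *;
    set (N := mean_N2 a b) in *; set (S := mean_S a b) in *.
  enough (A * S <= A * (5 * A - 4 * N)) by nra.
  assert (hAG : A * G = 2 * N ^ 2 - A ^ 2) by lra.
  apply le_of_pow2_le; [nra |].
  enough (0 <= (A * (5 * A - 4 * N)) ^ 2 - (A * S) ^ 2) by lra.
  replace ((A * S) ^ 2) with (2 * A ^ 4 - (2 * N ^ 2 - A ^ 2) ^ 2)
    by (rewrite <- hAG, (Rpow_mult_distr A S), hS2; ring).
  replace ((A * (5 * A - 4 * N)) ^ 2 - (2 * A ^ 4 - (2 * N ^ 2 - A ^ 2) ^ 2))
    with (4 * (A - N) ^ 2 * (N ^ 2 + 2 * A * N + 6 * A ^ 2)) by ring.
  pose proof (pow2_ge_0 (A - N)).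
  apply Rmult_le_pos; nra.
Qed.

Theorem theorem3p3 (a b : R) (ha : 0 < a) (hb : 0 < b) :
  (M_SA a b <= 4 / 5 * M_SN2 a b <= 4 * M_AN2 a b) /\
  (M_SH a b <= 2 * M_SN1 a b <= 3 / 2 * M_SG a b) /\
  (M_SA a b <= 3 / 4 * M_SN3 a b <= 2 / 3 * M_SN1 a b).
Proof.
  pose proof (mean_S_plus_G_le a b ha hb).
  pose proof (mean_A_plus_G_le a b ha hb).
  pose proof (mean_S_plus_4N2_le a b ha hb).
  unfold M_SA, M_SN1, M_SN2, M_SN3, M_SG, M_SH, M_AN2.
  rewrite mean_N1_eq, mean_N3_eq by assumption.
  lra.
Qed.
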